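(* Let $f(x,y)$ be a bivariate polynomial with non-negative integer coefficients and no constant term. Assume that for all integers $x',y'$ with $0<x',y'\leq f(2,2)$ and for all positive integers $a,b,c,d,x,y$ such that $x'=x+f(a,b)$ and $y'=y+f(c,d)$, the following hold: (1) if $f(a,b)$, $f(c,d)$, $f(x,y)$ are not all equal, then $\gcd(f(a,b),f(c,d),f(x,y))>1$; (2) if $f(a,b)=f(c,d)=f(x,y)$, then this common value is not prime. Then $f$ does not represent any prime, i.e., there are no positive integers $x,y$ with $f(x,y)$ prime.
   Context: A polynomial $f(x,y)$ is said to represent a prime if there exist positive integers $x,y$ such that $f(x,y)$ is a prime number.
   Formalization: The formal statement additionally assumes that f is neither the polynomial x nor the polynomial y; for these two the hypotheses hold (f(2,2)=2 forces all three values to be 1) but f represents the prime 2, so the claim fails. *)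

(* Defs.v *)
From mathcomp Require Import all_boot all_order all_algebra polyXY.

Set Implicit Arguments.
Unset Strict Implicit.
Unset Printing Implicit Defensive.

(* A bivariate polynomial with non-negative integer coefficients is an element
   of {poly {poly nat}}, following polyXY: x is the outer variable 'X, y is the
   inner variable 'Y = 'X%:P, and the coefficient of x^i y^j is f`_i`_j. *)
Definition value (f : {poly {poly nat}}) (x y : nat) : nat := f.[x, y]%R.

Definition represents_prime (f : {poly {poly nat}}) : Prop :=
  exists x y : nat, [/\ 0 < x, 0 < y & prime (value f x y)].

(* Main.v *)
(* Let s = f(1, 1) and N = f(2, 2), so that 2 s <= N since f has no constant
   term.  The hypothesis at a = b = c = d = 1 says that s is not prime and that
   f(x, y) is s or shares a factor with s whenever x, y <= N - s; as N - s >= s,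
   this range contains all residues mod s.  If s > 1, every value of f then
   shares a factor with s, so a prime value p divides s <= p and s = p is prime.
   If s = 1 and N > 2, then x = y = 2 gives f(2, 2) = 1.  If s = 1 and N = 2,
   then f is x or y. *)
Require Import Defs.
From mathcomp Require Import all_boot all_order all_algebra polyXY.

Set Implicit Arguments.
Unset Strict Implicit.
Unset Printing Implicit Defensive.

(** A single bound for the exponents of both variables, so that values of [f] become one sum over a
    fixed square of exponent pairs. *)
Definition coef_bound (f : {poly {poly nat}}) : nat :=
  maxn (size f) (\max_(i < size f) size (f`_i)%R).

Lemma size_coef_bound (f : {poly {poly nat}}) i : size (f`_i)%R <= coef_bound f.
Proof.
have [lt_i|ge_i] := ltnP i (size f); last by rewrite nth_default ?size_poly0.
rewrite /coef_bound leq_max; apply/orP; right.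
exact: (leq_bigmax (Ordinal lt_i)).
Qed.

Lemma valueE (f : {poly {poly nat}}) x y : value f x y =
  \sum_(p : 'I_(coef_bound f) * 'I_(coef_bound f))
     (f`_p.1`_p.2)%R * (x ^ p.1 * y ^ p.2).
Proof.
rewrite -(pair_bigA _ (fun i j : 'I__ => (f`_i`_j)%R * (x ^ i * y ^ j))) /=.
rewrite /value (@horner_coef_wide {poly nat} (coef_bound f)) ?leq_maxl //.
rewrite horner_sum.
apply: eq_bigr => i _; rewrite -polyC_exp hornerM hornerC.
rewrite (horner_coef_wide _ (size_coef_bound f i)) natrE big_distrl /=.
by apply: eq_bigr => j _; rewrite !natrE -mulnA [x ^ i * _]mulnC.
Qed.

Lemma value_leq (f : {poly {poly nat}}) x y x' y' :
  x <= x' -> y <= y' -> value f x y <= value f x' y'.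
Proof.
move=> le_x le_y; rewrite !valueE; apply: leq_sum => p _.
have le_exp m n e : m <= n -> m ^ e <= n ^ e.
  by case: e => // e; rewrite leq_exp2r.
by rewrite leq_mul2l leq_mul ?orbT ?le_exp.
Qed.

(** At (1, 1) the value is the sum of the coefficients; these are natural numbers, so all of them
    vanish. *)
Lemma value_eq0 (f : {poly {poly nat}}) x y :
  value f 1 1 = 0 -> value f x y = 0.
Proof.
rewrite !valueE => /eqP; rewrite sum_nat_eq0 => /forallP f0.
apply: big1 => p _; have /eqP := f0 p.
by rewrite !exp1n !muln1 => ->.
Qed.

Lemma value_modn (f : {poly {poly nat}}) x y x' y' d :
  x = x' %[mod d] -> y = y' %[mod d] ->
  value f x y = value f x' y' %[mod d].
Proof.
move=> eq_x eq_y; rewrite !valueE -modn_summ -[RHS]modn_summ.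
congr (_ %% d); apply: eq_bigr => p _.
have eq_exp m n e : m = n %[mod d] -> m ^ e = n ^ e %[mod d].
  by move=> eq_mn; rewrite -modnXm eq_mn modnXm.
rewrite -modnMmr -[RHS]modnMmr; congr (_ * _ %% d).
by rewrite -modnMm (eq_exp _ _ _ eq_x) (eq_exp _ _ _ eq_y) modnMm.
Qed.

(** A monomial of total degree i + j > 0 grows by the factor 2 ^ (i + j) >= 2 from (1, 1) to (2,
    2). *)
Lemma double_value11_leq (f : {poly {poly nat}}) : (f`_0`_0 = 0)%R ->
  2 * value f 1 1 <= value f 2 2.
Proof.
move=> f00; rewrite !valueE big_distrr; apply: leq_sum => -[i j] _ /=.
rewrite !exp1n !muln1 mulnC -expnD.
case: (posnP (i + j)) => [/eqP|ij_gt0]; last first.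
  by rewrite leq_mul2l (leq_exp2l 1) ?ij_gt0 ?orbT.
by rewrite addn_eq0 => /andP[/eqP-> /eqP->]; rewrite f00.
Qed.

(** Coefficient sum 1 leaves a single monomial x^i y^j, and 2 ^ (i + j) = 2 then forces i + j =
    1. *)
Lemma value_eqX_or_eqY (f : {poly {poly nat}}) :
  value f 1 1 = 1 -> value f 2 2 = 2 -> f = 'X%R \/ f = 'Y%R.
Proof.
rewrite !valueE => /eqP/sum_nat_eq1[[i j] [_ /=]].
rewrite !exp1n !muln1 => fij f0.
(* Extends the vanishing from the square to all indices: beyond [coef_bound f] coefficients are 0 by
   default. *)
have {}f0 k l : (k, l) != (nat_of_ord i, nat_of_ord j) -> (f`_k`_l)%R = 0.
  move=> kl; have [ltk|gek] := ltnP k (coef_bound f); last first.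
    by rewrite (nth_default _ (leq_trans (leq_maxl _ _) gek)) coef0.
  have [ltl|gel] := ltnP l (coef_bound f); last first.
    by rewrite nth_default // (leq_trans (size_coef_bound f k)).
  by move: (f0 (Ordinal ltk, Ordinal ltl) kl isT); rewrite /= !exp1n !muln1.
rewrite (bigD1 (i, j)) //= fij mul1n big1 ?addn0; last first.
  by move=> [k l] /= kl; rewrite f0.
rewrite -expnD => /eqP; rewrite (eqn_exp2l _ 1) //.
case: i j fij f0 => [[|[|i]] ?] [[|[|j]] ?] //= fij f0 _; [right | left];
  apply/polyP => k; apply/polyP => l.
- rewrite coefC; case: eqP => [->|/eqP k0].
    rewrite coefX; have [->|l1] := eqVneq l 1; first by rewrite fij.
    by rewrite f0 // xpair_eqE (negPf l1).
  by rewrite coef0 f0 // xpair_eqE (negPf k0).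
- rewrite coefX; have [->|k1] := eqVneq k 1.
    rewrite coef1; have [->|l0] := eqVneq l 0; first by rewrite fij.
    by rewrite f0 // xpair_eqE (negPf l0).
  by rewrite coef0 f0 // xpair_eqE (negPf k1).
Qed.

(** Residues are taken in 1..s instead of 0..s-1, since the hypothesis on [f] only covers positive
    arguments. *)
Lemma exists_pos_leq_modn s x : 0 < s -> 0 < x ->
  exists u, [/\ 0 < u, u <= s & u = x %[mod s]].
Proof.
move=> s_gt0 x_gt0; exists (x.-1 %% s).+1; split=> //.
  by rewrite ltn_pmod.
by rewrite -addn1 modnDml addn1 prednK.
Qed.

(* The two coordinate polynomials f = x and f = y are excluded because the
   claim fails for them: f(2, 2) = 2 then forces all three values to be 1. *)
Theorem theorem2 (f : {poly {poly nat}})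
    (f_no_const : (f`_0`_0 = 0)%R)
    (f_neq_x : f <> 'X%R) (f_neq_y : f <> 'Y%R)
    (f_hyp : forall x' y' : nat,
      0 < x' <= value f 2 2 -> 0 < y' <= value f 2 2 ->
      forall a b c d x y : nat,
      0 < a -> 0 < b -> 0 < c -> 0 < d -> 0 < x -> 0 < y ->
      x' = x + value f a b -> y' = y + value f c d ->
      (~ (value f a b = value f c d /\ value f c d = value f x y) ->
         1 < gcdn (gcdn (value f a b) (value f c d)) (value f x y))
      /\
      (value f a b = value f c d /\ value f c d = value f x y ->
         ~ prime (value f a b))) :
  ~ represents_prime f.
Proof.
set s := value f 1 1; set N := value f 2 2 in f_hyp.
have sN : 2 * s <= N := double_value11_leq f_no_const.
have [s0 [x [y [_ _]]]|s_gt0] := posnP s.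
  by rewrite value_eq0.
have hyp x y : 0 < x -> 0 < y -> s + x <= N -> s + y <= N ->
    (value f x y <> s -> 1 < gcdn s (value f x y)) /\
    (value f x y = s -> ~ prime s).
  move=> x_gt0 y_gt0 sx sy.
  have xN : 0 < x + s <= N by rewrite addn_gt0 x_gt0 addnC.
  have yN : 0 < y + s <= N by rewrite addn_gt0 y_gt0 addnC.
  have [h1 h2] := f_hyp _ _ xN yN 1 1 1 1 x y isT isT isT isT x_gt0 y_gt0
    erefl erefl.
  rewrite gcdnn in h1; split=> [ne_s|eq_s]; last exact: h2.
  by apply: h1 => -[_ /esym].
have s1N : s + 1 <= N by apply: leq_trans sN; rewrite mul2n -addnn leq_add2l.
have s_npr : ~ prime s by apply: (hyp 1 1 _ _ s1N s1N).2.
have s_gt1 : 1 < s.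
  rewrite ltn_neqAle s_gt0 andbT; apply/eqP => s1.
  have [N_le2|N_gt2] := leqP N 2; last first.
    have [||h _] := hyp 2 2 isT isT; rewrite -?s1 //.
    move: h; rewrite -s1 gcd1n -/N => h.
    by case: (N =P 1) h N_gt2 => [-> //|N1 /(_ N1)].
  have N2 : N = 2 by apply/eqP; rewrite eqn_leq N_le2 (leq_trans _ sN) // -s1.
  by case: (value_eqX_or_eqY (esym s1) N2).
move=> [x [y [x_gt0 y_gt0 p_pr]]].
have [u [u_gt0 u_le eq_u]] := exists_pos_leq_modn s_gt0 x_gt0.
have [v [v_gt0 v_le eq_v]] := exists_pos_leq_modn s_gt0 y_gt0.
have [||h _] := hyp u v u_gt0 v_gt0.
- by apply: leq_trans sN; rewrite mul2n -addnn leq_add2l.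
- by apply: leq_trans sN; rewrite mul2n -addnn leq_add2l.
(* The gcd with [s] depends only on the value mod [s], so (x, y) may be replaced by (u, v); if the
   value there is [s], the gcd is [s] > 1. *)
have gcd_gt1 : 1 < gcdn s (value f x y).
  rewrite -gcdn_modr -(value_modn f eq_u eq_v) gcdn_modr.
  by case: (value f u v =P s) => [->|//]; rewrite gcdnn.
have p_dvd_s : value f x y %| s.
  move: gcd_gt1; rewrite ltnNge; apply: contraNT.
  by rewrite -prime_coprime // coprime_sym /coprime => /eqP->.
apply: s_npr; suff -> : s = value f x y by [].
(* Monotonicity from (1, 1) gives one inequality, divisibility the other. *)
by apply/eqP; rewrite eqn_leq value_leq //= dvdn_leq.
Qed.
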